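(* Let $k$ be a field, $X$ a well-ordered set and $\Omega=\{\prec,\succ\}$ (two binary operations). With the ordering $>$ on $(X,\Omega)$ described in the context, the set $$S=\{(x\succ y)\prec z-x\succ (y\prec z)\mid x,y,z\in (X,\Omega)\}$$ is a Gröbner-Shirshov basis in the free $\Omega$-algebra $k(X,\Omega)$.
   Context: $(X,\Omega)$ is the set of $\Omega$-words: the smallest set of formal expressions containing $X$ and closed under $u,v\mapsto u\prec v$ and $u,v\mapsto u\succ v$. $k(X,\Omega)$ is the $k$-vector space with basis $(X,\Omega)$, the two operations being extended bilinearly. Ordering: write $|u|$ for the number of occurrences of elements of $X$ in $u$; write $\delta_1$ for $\succ$ and $\delta_2$ for $\prec$, with $\delta_1<\delta_2$. If $u=x\in X$ put $wt(u)=(1,x)$; if $u=\delta_i(u_1,u_2)$ put $wt(u)=(|u|,\delta_i,u_1,u_2)$. Define $u>v$ iff $wt(u)>wt(v)$ lexicographically, recursively by induction on $|u|+|v|$. A $\star$-$\Omega$-word is an element of $(X\cup\{\star\},\Omega)$ ($\star\notin X$) in which $\star$ occurs exactly once; $u|_s$ is the result of substituting $s\in k(X,\Omega)$ for $\star$ in $u$. For $0\neq f\in k(X,\Omega)$, $\bar f$ is the largest $\Omega$-word occurring in $f$ with nonzero coefficient; $f$ is monic if this coefficient is $1$. For monic $f,g$, if $w=\bar f=u|_{\bar g}$ for some $\star$-$\Omega$-word $u$, then $(f,g)_w=f-u|_g$ is called the composition of $f$ and $g$ with respect to $w$. For a set $S$ of monic polynomials, $(f,g)_w$ is trivial modulo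 $(S,w)$ if $(f,g)_w=\sum_i\alpha_i u_i|_{s_i}$ (finite sum) with $\alpha_i\in k$, $u_i$ $\star$-$\Omega$-words, $s_i\in S$ and $u_i|_{\overline{s_i}}<w$. $S$ is a Gröbner-Shirshov basis in $k(X,\Omega)$ if for all $f,g\in S$ every composition $(f,g)_w$ is trivial modulo $(S,w)$. *)

(* Defs.v *)
From HB Require Import structures.
From mathcomp Require Import all_boot all_order all_algebra finmap.
From mathcomp Require Export monalg.

Set Implicit Arguments.
Unset Strict Implicit.
Unset Printing Implicit Defensive.

Import Order.TTheory GRing.Theory.

Local Open Scope ring_scope.

Inductive omega : Type := Succ | Prec.

(* delta_1 is \succ and delta_2 is \prec, compared by index. *)
Definition omega_idx (d : omega) : nat := if d is Succ then 1 else 2.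

Lemma omega_idx_inj : injective omega_idx.
Proof. by case; case. Qed.

Inductive word (X : Type) : Type :=
| Var of X
| Op of omega & word X & word X.

Declare Scope word_scope.
Delimit Scope word_scope with W.

Notation "u '\succ' v" := (Op Succ u v)
  (at level 40, no associativity) : word_scope.
Notation "u '\prec' v" := (Op Prec u v)
  (at level 40, no associativity) : word_scope.

Fixpoint deg (X : Type) (u : word X) : nat :=
  match u with
  | Var _ => 1
  | Op _ u1 u2 => (deg u1 + deg u2)%N
  end.

Lemma deg_gt0 (X : Type) (u : word X) : (0 < deg u)%N.
Proof. by elim: u => //= d u IHu v _; rewrite addn_gt0 IHu. Qed.

Section WordChoice.
Variable X : choiceType.

Fixpoint tree_of_word (u : word X) : GenTree.tree X :=
  match u with
  | Var x => GenTree.Leaf x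
  | Op d u1 u2 =>
      GenTree.Node (omega_idx d) [:: tree_of_word u1; tree_of_word u2]
  end.

Fixpoint word_of_tree (t : GenTree.tree X) : option (word X) :=
  match t with
  | GenTree.Leaf x => Some (Var x)
  | GenTree.Node n [:: t1; t2] =>
      match word_of_tree t1, word_of_tree t2 with
      | Some u1, Some u2 => Some (Op (if n == 1 then Succ else Prec) u1 u2)
      | _, _ => None
      end
  | _ => None
  end.

Lemma tree_of_wordK : pcancel tree_of_word word_of_tree.
Proof. by elim=> //= d u -> v ->; case: d. Qed.

HB.instance Definition _ := Choice.copy (word X) (pcan_type tree_of_wordK).

End WordChoice.

Lemma lexn_trans (m n p : nat) (A B C : bool) : (A -> B -> C) ->
  (m < n)%N || (m == n) && A -> (n < p)%N || (n == p) && B ->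
  (m < p)%N || (m == p) && C.
Proof.
move=> ABC /orP[lt1|/andP[/eqP-> a]] /orP[lt2|/andP[/eqP<- b]].
- by rewrite (ltn_trans lt1 lt2).
- by rewrite lt1.
- by rewrite lt2.
- by rewrite eqxx ABC ?orbT.
Qed.

Lemma lexn_total (m n : nat) (A B : bool) : (m = n -> A || B) ->
  (m < n)%N || (m == n) && A || ((n < m)%N || (n == m) && B).
Proof. by move=> AB; case: ltngtP => //= /AB. Qed.

Section WordOrder.
Context (disp : Order.disp_t) (X : orderType disp).

(* Lexicographic comparison of wt; on words of equal degree either both are
   letters or both are compound, so the last branch is never decisive. *)
Fixpoint wlt (u v : word X) : bool :=
  (deg u < deg v)%N ||
  (deg u == deg v) &&
  match u, v with
  | Var x, Var y => (x < y)%O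
  | Op d u1 u2, Op e v1 v2 =>
      (omega_idx d < omega_idx e)%N ||
      (omega_idx d == omega_idx e) && (wlt u1 v1 || (u1 == v1) && wlt u2 v2)
  | _, _ => false
  end.

Definition wle (u v : word X) : bool := (u == v) || wlt u v.

Lemma deg_Op_Var (d : omega) (u v : word X) (x : X) :
  (deg (Op d u v) == deg (Var x)) = false.
Proof.
rewrite /=; have := deg_gt0 u; have := deg_gt0 v.
by case: (deg u) (deg v) => [|m] [|n] // _ _; rewrite addnS.
Qed.

Lemma wlt_irr : irreflexive wlt.
Proof.
elim=> [x|d u IHu v IHv] /=; first by rewrite ltxx.
by rewrite !ltnn !eqxx IHu IHv.
Qed.

Lemma wlt_trans : transitive wlt.
Proof.
move=> v u w; elim: u v w => [x|d u1 IH1 u2 IH2] [y|e v1 v2] [z|f w1 w2];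
  apply: lexn_trans => //; first exact: lt_trans.
rewrite -!/(wlt _ _); apply: lexn_trans => /orP[lt1|/andP[/eqP-> lt1]] /orP[lt2|/andP[/eqP<- lt2]].
- by rewrite (IH1 _ _ lt1 lt2).
- by rewrite lt1.
- by rewrite lt2.
- by rewrite eqxx (IH2 _ _ lt1 lt2) orbT.
Qed.

Lemma wlt_total (u v : word X) : u != v -> wlt u v || wlt v u.
Proof.
elim: u v => [x|d u1 IH1 u2 IH2] [y|e v1 v2] neq; apply: lexn_total => eq_deg.
- by rewrite -neq_lt; apply: contraNneq neq => ->.
- by have := deg_Op_Var e v1 v2 x; rewrite eq_deg eqxx.
- by have := deg_Op_Var d u1 u2 y; rewrite eq_deg eqxx.
rewrite -!/(wlt _ _); apply: lexn_total => /omega_idx_inj eqd.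
have [eq1|ne1] := eqVneq u1 v1; last first.
  by rewrite !orbF; apply: IH1.
have ne2 : u2 != v2 by apply: contraNneq neq => ->; rewrite eqd eq1.
by rewrite eq1 wlt_irr /=; apply: IH2.
Qed.

HB.instance Definition _ := Order.LtOrder.Build disp (word X)
  (fun _ _ => erefl : wle _ _ = _) (fun _ _ => erefl) (fun _ _ => erefl)
  wlt_irr wlt_trans wlt_total.

Lemma wltE (u v : word X) : (u < v)%O = wlt u v.
Proof. by []. Qed.

End WordOrder.

Notation walg k X := {malg k[word X]}.

Section Substitution.
Context (k : fieldType) (X : choiceType).

(* Bilinear extension of the operation d from words to k(X, Omega). *)
Definition opA (d : omega) (f g : walg k X) : walg k X :=
  \sum_(u <- msupp f) \sum_(v <- msupp g) << f@_u * g@_v *g Op d u v >>.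

Lemma opAU (d : omega) (u v : word X) :
  opA d << u >> << v >> = << Op d u v >>.
Proof.
by rewrite /opA !msuppU !oner_eq0 !big_seq_fset1 !mcoeffUU mulr1.
Qed.

(* The letter None : option X plays the role of the hole. *)
Fixpoint nstar (u : word (option X)) : nat :=
  match u with
  | Var None => 1
  | Var (Some _) => 0
  | Op _ u1 u2 => (nstar u1 + nstar u2)%N
  end.

Definition star_word (u : word (option X)) : Prop := nstar u = 1%N.

Fixpoint wsubst (u : word (option X)) (v : word X) : word X :=
  match u with
  | Var None => v
  | Var (Some x) => Var x
  | Op d u1 u2 => Op d (wsubst u1 v) (wsubst u2 v)
  end.

Fixpoint asubst (u : word (option X)) (s : walg k X) : walg k X :=
  match u with
  | Var None => s
  | Var (Some x) => << Var x >>
  | Op d u1 u2 => opA d (asubst u1 s) (asubst u2 s)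
  end.

Lemma asubstU (u : word (option X)) (v : word X) :
  asubst u << v >> = << wsubst u v >>.
Proof. by elim: u => [[]|d u IHu w IHw] //=; rewrite IHu IHw opAU. Qed.

End Substitution.

Section GroebnerShirshov.
Context (k : fieldType) (disp : Order.disp_t) (X : orderType disp).
Implicit Types (f g h : walg k X) (u : word (option X)) (w : word X).

Definition is_lead f w : Prop :=
  w \in msupp f /\ forall v, v \in msupp f -> (v <= w)%O.

Lemma is_lead_uniq f w w' : is_lead f w -> is_lead f w' -> w = w'.
Proof.
move=> [fw maxw] [fw' maxw'].
by apply/le_anti; rewrite maxw' // maxw.
Qed.

Definition monic f : Prop := exists2 w, is_lead f w & f@_w = 1.

Definition composition f g u : walg k X := f - asubst u g.

Definition trivial_mod (S : walg k X -> Prop) w h : Prop :=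
  exists (n : nat) (a : 'I_n -> k) (u : 'I_n -> word (option X))
         (s : 'I_n -> walg k X),
    (forall i, [/\ star_word (u i), S (s i) &
       exists2 v, is_lead (s i) v & (wsubst (u i) v < w)%O]) /\
    h = \sum_(i < n) a i *: asubst (u i) (s i).

Definition groebner_shirshov (S : walg k X -> Prop) : Prop :=
  (forall f, S f -> monic f) /\
  forall f g u w wg,
    S f -> S g -> star_word u -> is_lead f w -> is_lead g wg ->
    w = wsubst u wg -> trivial_mod S w (composition f g u).

Definition l_relations f : Prop :=
  exists x y z : word X,
    f = << ((x \succ y) \prec z)%W >> - << (x \succ (y \prec z))%W >>.

End GroebnerShirshov.

(* Main.v *)
Require Import Defs.
From mathcomp Require Import all_boot all_order all_algebra.
From mathcomp Require Import finmap.

(** Write the relation as [lhs - rhs] with [lhs = (x \succ y) \prec z] and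
    [rhs = x \succ (y \prec z)].  Both words have the same degree and
    [\prec] is the larger operation, so [lhs] is the leading word
    ([is_lead_l_rel]).

    Let the leading word [w] of a relation be [u|_a], where [a] is the leading
    word of a second relation [g = a - b].  Either [u] is the bare hole, and
    the two relations coincide; or, since [a] has root [\prec] and so cannot
    be the factor [x \succ y], the star word itself has the shape
    [u = (p \succ q) \prec r] ([wsubst_eq_lhs]), where the hole lies in one of
    [p], [q], [r].  All three positions are treated at once: with
    [v = p \succ (q \prec r)], linearity of substitution in a star word
    ([asubstB]) gives
      [(u|_a - v|_a) - u|_g = (u|_b - v|_b) - v|_g]
    ([composition_l_rel]).
    On the right the first difference is again a relation, with leading word
    [u|_b < u|_a = w] by monotonicity of substitution ([wsubst_mono]), and
    [v|_a < u|_a = w] because [\succ] is the smaller operation.  Hence every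
    composition is trivial. *)

Set Implicit Arguments.
Unset Strict Implicit.
Unset Printing Implicit Defensive.

Import Order.TTheory GRing.Theory.
Local Open Scope ring_scope.

Lemma subrBB (V : zmodType) (uA vA uB vB : V) :
  (uA - vA) - (uA - uB) = (uB - vB) - (vA - vB).
Proof. by rewrite !opprB [LHS]addrC !subrKA. Qed.

Section Linearity.
Context (k : fieldType) (X : choiceType).
Implicit Types (f g h : walg k X) (u : word (option X)) (d : omega).

(** Summing over any finite sets containing the supports changes nothing;
    this frees additivity arguments from the support of a difference. *)
Lemma opAEw d f g (D E : {fset word X}) :
  (msupp f `<=` D)%fset -> (msupp g `<=` E)%fset ->
  opA d f g = \sum_(u <- D) \sum_(v <- E) << f@_u * g@_v *g Op d u v >>.
Proof.
move=> fD gE; rewrite /opA.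
under eq_bigr => u _.
  rewrite (big_fset_incl _ gE); last first.
    by move=> v _ /mcoeff_outdom ->; rewrite mulr0 monalgU0.
  over.
apply: (big_fset_incl _ fD) => u _ /mcoeff_outdom fu0.
by apply: big1 => v _; rewrite fu0 mul0r monalgU0.
Qed.

Lemma opABl d f g h : opA d (f - g) h = opA d f h - opA d g h.
Proof.
pose D := (msupp (f - g) `|` (msupp f `|` msupp g))%fset.
have sfg : (msupp (f - g) `<=` D)%fset by apply: fsubsetUl.
have sf : (msupp f `<=` D)%fset by rewrite /D fsetUCA fsubsetUl.
have sg : (msupp g `<=` D)%fset by rewrite /D fsetUA fsubsetUr.
have sh := fsubset_refl (msupp h).
rewrite (opAEw d sfg sh) (opAEw d sf sh) (opAEw d sg sh) -sumrB.
apply: eq_bigr => u _; rewrite -sumrB; apply: eq_bigr => v _.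
by rewrite mcoeffB mulrBl monalgUB.
Qed.

Lemma opABr d f g h : opA d h (f - g) = opA d h f - opA d h g.
Proof.
pose D := (msupp (f - g) `|` (msupp f `|` msupp g))%fset.
have sfg : (msupp (f - g) `<=` D)%fset by apply: fsubsetUl.
have sf : (msupp f `<=` D)%fset by rewrite /D fsetUCA fsubsetUl.
have sg : (msupp g `<=` D)%fset by rewrite /D fsetUA fsubsetUr.
have sh := fsubset_refl (msupp h).
rewrite (opAEw d sh sfg) (opAEw d sh sf) (opAEw d sh sg) -sumrB.
apply: eq_bigr => u _; rewrite -sumrB; apply: eq_bigr => v _.
by rewrite mcoeffB mulrBr monalgUB.
Qed.

Lemma asubst_nstar0 u f g : nstar u = 0%N -> asubst u f = asubst u g.
Proof.
elim: u => [[x|]|d u IHu v IHv]; [by [] | by [] |].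
move=> /= /eqP; rewrite addn_eq0 => /andP[/eqP nu /eqP nv].
by rewrite (IHu nu) (IHv nv).
Qed.

(** Exactly one hole is what makes substitution linear: with none it is
    constant, with several it has a higher degree in what is substituted. *)
Lemma asubstB u f g : star_word u ->
  asubst u (f - g) = asubst u f - asubst u g.
Proof.
rewrite /star_word; elim: u => [[x|]|d u IHu v IHv]; [by [] | by [] |].
move=> /= /eqP; case nu: (nstar u) => [|[|n]]; last by [].
  move=> /eqP nv; rewrite (IHv nv) opABr.
  by rewrite (asubst_nstar0 (f - g) 0 nu) (asubst_nstar0 f 0 nu)
             (asubst_nstar0 g 0 nu).
rewrite add1n => /eqP[nv]; rewrite (IHu nu) opABl.
by rewrite (asubst_nstar0 (f - g) 0 nv) (asubst_nstar0 f 0 nv)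
           (asubst_nstar0 g 0 nv).
Qed.

End Linearity.

Section Order.
Context (disp : Order.disp_t) (X : orderType disp).
Implicit Types (u : word (option X)) (a b c x y z : word X) (d : omega).

Lemma wlt_deg a b : (a < b)%O -> (deg a <= deg b)%N.
Proof.
rewrite leqNgt; apply: contraL => ba; rewrite -leNgt ltW // wltE.
by case: a b ba => [x|d a1 a2] [y|e b1 b2] //= ->.
Qed.

Lemma ltw_OpE d a1 a2 b1 b2 :
  (Op d a1 a2 < Op d b1 b2)%O =
    (deg a1 + deg a2 < deg b1 + deg b2)%N ||
    (deg a1 + deg a2 == deg b1 + deg b2)%N &&
    ((a1 < b1)%O || (a1 == b1) && (a2 < b2)%O).
Proof. by rewrite wltE /= ltnn eqxx. Qed.

Lemma ltw_Opl d a b c : (a < b)%O -> (Op d a c < Op d b c)%O.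
Proof.
move=> ab; rewrite ltw_OpE ab ltn_add2r eqn_add2r andbT orbC -leq_eqVlt.
exact: wlt_deg.
Qed.

Lemma ltw_Opr d a b c : (a < b)%O -> (Op d c a < Op d c b)%O.
Proof.
move=> ab; rewrite ltw_OpE ab eqxx orbT ltn_add2l eqn_add2l andbT orbC.
by rewrite -leq_eqVlt; apply: wlt_deg.
Qed.

Lemma wsubst_nstar0 u a b : nstar u = 0%N -> wsubst u a = wsubst u b.
Proof.
elim: u => [[]|d u IHu v IHv] //= /eqP.
by rewrite addn_eq0 => /andP[/eqP/IHu-> /eqP/IHv->].
Qed.

Lemma wsubst_mono u a b : star_word u ->
  (a < b)%O -> (wsubst u a < wsubst u b)%O.
Proof.
move=> + ab; rewrite /star_word; elim: u => [[]|d u IHu v IHv] //= /eqP.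
case nu: (nstar u) => [|[|n]] //.
  by move=> /eqP nv; rewrite (wsubst_nstar0 a b nu) ltw_Opr ?IHv.
by rewrite add1n => /eqP[nv]; rewrite (wsubst_nstar0 a b nv) ltw_Opl ?IHu.
Qed.

Lemma ltw_assoc x y z : (x \succ (y \prec z) < (x \succ y) \prec z)%W%O.
Proof. by rewrite wltE /= addnA eqxx orbT. Qed.

(** The hole cannot be the factor [x \succ y], because the word filling it
    has root [\prec]; so a left-hand side properly inside another one lies
    within [x], [y] or [z]. *)
Lemma wsubst_eq_lhs u a b x y z :
  wsubst u (a \prec b)%W = ((x \succ y) \prec z)%W ->
  u = Var None \/ exists p q r, u = ((p \succ q) \prec r)%W.
Proof.
case: u => [[]|d u1 r] //=; first by left.
case=> -> u1E _; right; case: u1 u1E => [[]|e p q] //= [-> _ _].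
by exists p, q, r.
Qed.

End Order.

Section Relations.
Context (k : fieldType) (disp : Order.disp_t) (X : orderType disp).
Implicit Types (f g : walg k X) (u : word (option X)) (w x y z : word X).

Definition l_rel x y z : walg k X :=
  << ((x \succ y) \prec z)%W >> - << (x \succ (y \prec z))%W >>.

Lemma mcoeff_l_rel x y z w :
  (l_rel x y z)@_w =
    (((x \succ y) \prec z)%W == w)%:R - ((x \succ (y \prec z))%W == w)%:R.
Proof. by rewrite /l_rel mcoeffB; congr (_ - _); exact: mcoeffU. Qed.

Lemma mcoeff_l_rel_lead x y z : (l_rel x y z)@_((x \succ y) \prec z)%W = 1.
Proof. by rewrite mcoeff_l_rel eqxx (lt_eqF (ltw_assoc x y z)) subr0. Qed.

Lemma is_lead_l_rel x y z : is_lead (l_rel x y z) ((x \succ y) \prec z)%W.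
Proof.
split; first by rewrite -mcoeff_neq0 mcoeff_l_rel_lead oner_eq0.
move=> v; rewrite -mcoeff_neq0 mcoeff_l_rel.
case: (_ =P v) => [<- //|_]; case: (_ =P v) => [<- _|_].
  exact/ltW/ltw_assoc.
by rewrite subr0 eqxx.
Qed.

Lemma asubst_l_rel u x y z : star_word u ->
  asubst u (l_rel x y z) =
    << wsubst u ((x \succ y) \prec z)%W >> -
    << wsubst u (x \succ (y \prec z))%W >>.
Proof.
by move=> su; rewrite (asubstB _ _ su); congr (_ - _); exact: asubstU.
Qed.

Lemma trivial_mod0 (S : walg k X -> Prop) w : trivial_mod S w 0.
Proof.
exists 0%N, (fun=> 0), (fun=> Var None), (fun=> 0).
by split; [case | rewrite big_ord0].
Qed.

Lemma trivial_modB (S : walg k X -> Prop) w u1 u2 f g v1 v2 :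
  star_word u1 -> S f -> is_lead f v1 -> (wsubst u1 v1 < w)%O ->
  star_word u2 -> S g -> is_lead g v2 -> (wsubst u2 v2 < w)%O ->
  trivial_mod S w (asubst u1 f - asubst u2 g).
Proof.
move=> su1 Sf fv1 lt1 su2 Sg gv2 lt2.
pose pick T (t1 t2 : T) (i : 'I_2) := if i == ord0 then t1 else t2.
exists 2%N, (pick k 1 (-1)), (pick _ u1 u2), (pick _ f g); split.
  move=> i; rewrite /pick; case: ifP => _.
    by split=> //; exists v1.
  by split=> //; exists v2.
by rewrite !big_ord_recl big_ord0 /pick /= scale1r scaleN1r addr0.
Qed.

(** With [u = (p \succ q) \prec r] and [v = p \succ (q \prec r)], rewriting
    at the root ([u] to [v]) and in the hole ([A] to [B]) commute: both orders
    lead from [u|_A] to [v|_B].  The differences along either route thus sum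
    to [u|_A - v|_B], and the identity follows by moving two of them across. *)
Lemma composition_l_rel p q r a b c :
  let A := ((a \succ b) \prec c)%W in
  let B := (a \succ (b \prec c))%W in
  star_word ((p \succ q) \prec r)%W ->
  composition (l_rel (wsubst p A) (wsubst q A) (wsubst r A)) (l_rel a b c)
    ((p \succ q) \prec r)%W =
  l_rel (wsubst p B) (wsubst q B) (wsubst r B) -
  asubst (p \succ (q \prec r))%W (l_rel a b c).
Proof.
move=> A B su.
have sv : star_word (p \succ (q \prec r))%W.
  by move: su; rewrite /star_word /= addnA.
rewrite /composition (asubst_l_rel _ _ _ su) (asubst_l_rel _ _ _ sv).
exact: subrBB.
Qed.

Lemma l_relationsP f : l_relations f -> exists x y z, f = l_rel x y z.
Proof. by []. Qed.

End Relations.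

Theorem theorem3p2 (k : fieldType) (disp : Order.disp_t) (X : orderType disp)
    (X_wf : well_founded (fun x y : X => (x < y)%O)) :
  groebner_shirshov (@l_relations k disp X).
Proof.
split=> [f /l_relationsP[x [y [z ->]]]|].
  exists ((x \succ y) \prec z)%W; first exact: is_lead_l_rel.
  exact: mcoeff_l_rel_lead.
move=> f g u w wg /l_relationsP[x [y [z ->]]] /l_relationsP[a [b [c ->]]] su.
move=> /is_lead_uniq/(_ (is_lead_l_rel k x y z))->.
move=> /is_lead_uniq/(_ (is_lead_l_rel k a b c))-> shape.
have [u_hole|[p [q [r u_def]]]] := wsubst_eq_lhs (esym shape).
  move: shape; rewrite u_hole /= => -[-> -> ->].
  by rewrite /composition subrr; apply: trivial_mod0.
rewrite u_def in su shape *; case: shape => -> -> ->.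
rewrite (composition_l_rel k a b c su).
pose B := (a \succ (b \prec c))%W.
rewrite -[l_rel k (wsubst p B) _ _]/(asubst (Var None) _).
apply: trivial_modB.
- by [].
- by exists (wsubst p B), (wsubst q B), (wsubst r B).
- exact: is_lead_l_rel.
- exact: (wsubst_mono su (ltw_assoc a b c)).
- by move: su; rewrite /star_word /= addnA.
- by exists a, b, c.
- exact: is_lead_l_rel.
- exact: ltw_assoc.
Qed.
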